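(* Let $d\ge 1$, let $\{\xi(i,m)\}$ ($1\le i\le n$, $1\le m\le d$) be a family of mutually independent centered real random variables, and let $p>2$ be such that $W_d(p)=\prod_{m=1}^d\mu_m(p)<\infty$. Define the sequence $\kappa(d)$, $d=1,2,\dots$, by $$\kappa(1)=K_R,\qquad \kappa(d+1)=\kappa(d)\cdot K_{Os}\cdot\left(1+\frac1d\right)^d .$$ Then $$U(p;d,n)\;\le\;\kappa(d)\cdot\frac{p^d}{(\ln p)^d}\cdot W_d(p)\;=\;\kappa(d)\cdot\frac{p^d}{(\ln p)^d}\cdot\prod_{m=1}^d\mu_m(p).$$
   Context: Setting and notation. The random variables $\xi(i,m)$, $i=1,\dots,n$ ($n\le\infty$), $m=1,\dots,d$, are defined on a probability space $(\Omega,F,\mathbf P)$, with $\mathbf E\xi(i,m)=0$; all of them (over both indices) are jointly independent. $I(d,n)$ is the set of multi-indices $\vec i=(i_1,\dots,i_d)$ with $1\le i_1<i_2<\dots<i_d\le n$. For $\vec i\in I(d,n)$ put $\xi(\vec i)=\prod_{s=1}^d\xi(i_s,s)$. For a non-random real array $b=(b(\vec i))$, symmetric in its arguments, put $$Q(d,n,b)=\sum_{\vec i\in I(d,n)}b(\vec i)\,\xi(\vec i),$$ where for $n=\infty$ this means the almost sure limit as $n\to\infty$, if it exists. Put $\|b\|^2=\sum_{\vec i\in I(d,n)}b^2(\vec i)$, and let $B$ be the set of all $b$ with $\|b\|=1$. For a random variable $\eta$ and $p>2$, $|\eta|_p=(\mathbf E|\eta|^p)^{1/p}$. Put $$U(p;d,n)=\sup_{b\in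 B}|Q(d,n,b)|_p,\qquad \mu_m(p)=\sup_i|\xi(i,m)|_p .$$ Constants. Osekowski's constant is $$K_{Os}=\sup_{p\ge4}\frac{Os(p)}{p/\ln p}\approx15.7858,\qquad Os(p)=4\sqrt2\left(\frac p4+1\right)^{1/p}\left(1+\frac{p}{\ln(p/2)}\right).$$ $K_R$ is Rosenthal's constant, $K_R\approx1.77638/e\approx0.6535$; it is the constant in the (known) Rosenthal inequality $$n^{-1/2}\left|\sum_{k=1}^n\xi_k\right|_p\le K_R\cdot\frac{p}{\ln p}\cdot\sqrt{n^{-1}\sum_{k=1}^n|\xi_k|_p^2}$$ for centered independent random variables $\xi_1,\dots,\xi_n$ with finite $p$-th moments. *)

(* Defs.v *)
From HB Require Import structures.
From mathcomp Require Import all_boot all_order all_algebra.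
From mathcomp Require Import finmap.
From mathcomp Require Import all_classical all_reals all_analysis.

Set Implicit Arguments.
Unset Strict Implicit.
Unset Printing Implicit Defensive.

Import Order.TTheory GRing.Theory Num.Theory.
Import numFieldNormedType.Exports.

Local Open Scope classical_set_scope.
Local Open Scope ring_scope.

Definition mutually_independent {disp : measure_display}
    {T : measurableType disp} {R : realType} (P : probability T R)
    {I : choiceType} (D : set I) (X : I -> {RV P >-> R}) : Prop :=
  forall (J : {fset I}) (A : I -> set R),
    [set` J] `<=` D ->
    (forall j, j \in J -> measurable (A j)) ->
    P (\bigcap_(j in [set` J]) (X j @^-1` A j)) =
    (\prod_(j <- J) P (X j @^-1` A j))%E.

Definition centered {disp : measure_display} {T : measurableType disp}
    {R : realType} (P : probability T R) (X : {RV P >-> R}) : Prop :=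
  P.-integrable setT (EFin \o X) /\ ('E_P[X] = 0)%E.

Definition pnorm {disp : measure_display} {T : measurableType disp}
    {R : realType} (P : probability T R) (p : R) (X : T -> R) : \bar R :=
  ('N[P]_(p%:E)[EFin \o X])%E.

Definition rosenthal_inequality {R : realType} (C : R) : Prop :=
  forall (disp : measure_display) (T : measurableType disp)
    (P : probability T R) (p : R) (n : nat) (xi : 'I_n -> {RV P >-> R}),
    2 < p -> (0 < n)%N ->
    mutually_independent setT xi ->
    (forall k, centered (xi k)) ->
    (forall k, (pnorm P p (xi k) < +oo)%E) ->
    (((Num.sqrt n%:R)^-1)%:E * pnorm P p (fun w => (\sum_(k < n) xi k w)%R) <=
     (C * (p / ln p) *
      Num.sqrt (n%:R^-1 * \sum_(k < n) fine (pnorm P p (xi k)) ^+ 2))%:E)%E.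

(* The least C admissible in Rosenthal's inequality. If there were none, [inf]
   would return 0, so finiteness is not built in. *)
Definition K_R (R : realType) : R := inf [set C : R | rosenthal_inequality C].

Definition Os {R : realType} (p : R) : R :=
  4 * Num.sqrt 2 * (p / 4 + 1) `^ p^-1 * (1 + p / ln (p / 2)).

Definition K_Os (R : realType) : R :=
  sup [set Os p / (p / ln p) | p in [set p : R | 4 <= p]].

(* The value at d = 0 is irrelevant: the sequence starts at d = 1. *)
Fixpoint kappa (R : realType) (d : nat) : R :=
  match d with
  | 0 | 1 => K_R R
  | d'.+1 => kappa R d' * K_Os R * (1 + d'%:R^-1) ^+ d'
  end.

(* [n : option nat] stands for n <= oo, with [None] for n = oo; the indices
   1, ..., n are shifted to 0, ..., n - 1. *)

Definition below (n : option nat) (i : nat) : bool :=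
  if n is Some N then (i < N)%N else true.

Definition multi_index {d : nat} (n : option nat) : set (d.-tuple nat) :=
  [set i | sorted ltn i && all (below n) i].

Definition symmetric_array {R : realType} {d : nat} (b : d.-tuple nat -> R) :
    Prop :=
  forall i j : d.-tuple nat, perm_eq i j -> b i = b j.

Definition sqnorm {R : realType} {d : nat} (n : option nat)
    (b : d.-tuple nat -> R) : \bar R :=
  (\esum_(i in multi_index n) (b i ^+ 2)%:E)%E.

Definition unit_arrays {R : realType} {d : nat} (n : option nat) :
    set (d.-tuple nat -> R) :=
  [set b | symmetric_array b /\ (sqnorm n b = 1)%E].

Definition xi_prod {disp : measure_display} {T : measurableType disp}
    {R : realType} {P : probability T R} {d : nat}
    (xi : nat -> 'I_d -> {RV P >-> R}) (i : d.-tuple nat) (w : T) : R :=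
  \prod_(s < d) xi (tnth i s) s w.

Definition Qfin {disp : measure_display} {T : measurableType disp}
    {R : realType} {P : probability T R} {d : nat}
    (xi : nat -> 'I_d -> {RV P >-> R}) (N : nat) (b : d.-tuple nat -> R)
    (w : T) : R :=
  \sum_(i \in multi_index (Some N)) b i * xi_prod xi i w.

(* [is_Q xi n b q]: q is Q(d, n, b). For n = oo this is a relation because the
   almost sure limit need not exist and is unique only up to null sets. *)
Definition is_Q {disp : measure_display} {T : measurableType disp}
    {R : realType} {P : probability T R} {d : nat}
    (xi : nat -> 'I_d -> {RV P >-> R}) (n : option nat)
    (b : d.-tuple nat -> R) (q : {RV P >-> R}) : Prop :=
  match n with
  | Some N => forall w, q w = Qfin xi N b w
  | None => {ae P, forall w, Qfin xi N b w @[N --> \oo] --> q w}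
  end.

(* The supremum runs over the b for which Q(d, n, b) exists. *)
Definition U {disp : measure_display} {T : measurableType disp}
    {R : realType} {P : probability T R} (p : R) {d : nat} (n : option nat)
    (xi : nat -> 'I_d -> {RV P >-> R}) : \bar R :=
  ereal_sup [set u | exists (b : d.-tuple nat -> R) (q : {RV P >-> R}),
    [/\ unit_arrays n b, is_Q xi n b q & u = pnorm P p q]].

Definition mu {disp : measure_display} {T : measurableType disp}
    {R : realType} {P : probability T R} (p : R) {d : nat} (n : option nat)
    (xi : nat -> 'I_d -> {RV P >-> R}) (m : 'I_d) : \bar R :=
  ereal_sup [set pnorm P p (xi i m) | i in [set i | below n i]].

Definition W {disp : measure_display} {T : measurableType disp}
    {R : realType} {P : probability T R} (p : R) {d : nat} (n : option nat)
    (xi : nat -> 'I_d -> {RV P >-> R}) : \bar R :=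
  (\prod_(m < d) mu p n xi m)%E.

(* Main.v *)
Require Import Defs.
From HB Require Import structures.
From mathcomp Require Import all_boot all_order all_algebra.
From mathcomp Require Import finmap.
From mathcomp Require Import all_classical all_reals all_analysis.
From mathcomp Require Import measurable_realfun.
From mathcomp Require Import ring lra.

Set Implicit Arguments.
Unset Strict Implicit.
Unset Printing Implicit Defensive.

Import Order.TTheory GRing.Theory Num.Theory.
Import numFieldNormedType.Exports.

Local Open Scope classical_set_scope.
Local Open Scope ring_scope.


(** Write [L = p / ln p]. For [d = 1] the bound is Rosenthal's inequality with its
    best constant [K_R]. For larger [d], group the multi-indices by their largest
    entry [k] (with the indices counted from 0):
      [Q(d + 1, N, b) = \sum_(k < N) Q(d, k, b(., k)) xi(k, d)].
    The variables of the last family are centered and independent of all the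
    chaoses [Q(d, k, b(., k))], which only involve the first [d] families. The
    partial sums therefore form a martingale whose increments are products of two
    independent factors. For such sums there is a Pythagorean inequality
    (pnorm_sum_orthogonal): the squared [p]-norm of the sum is at most [8 p] times
    the sum of the squared [p]-norms of the increments. As the squared norms of
    the arrays [b(., k)] add up to that of [b], passing from [d] to [d + 1] costs
    a factor [sqrt (8 p)] times the [mu] of the last family (pnorm_Qfin_le). This
    factor is affordable because [sqrt (8 p) <= 6 L] (ln_sqrt_bound), whereas
    the supremum [K_Os] exceeds 8 already at [p = 4] (K_Os_ge8).

    The Pythagorean inequality is elementary. For one increment [D] added to a
    partial sum [A], expand [`|A + D| `^ p] to the second order (powR_taylor): the
    first-order term has mean zero because [D] contains an independent centered
    factor, and Hoelder's inequality bounds the second-order term. This is enough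
    if [D] is smaller than [A / p] in norm, and Minkowski's inequality is enough
    otherwise (pnorm_add_orthogonal).

    The same inequality, for increments that are independent variables, shows
    that 6 is an admissible constant in Rosenthal's inequality. Thus [K_R] is the
    infimum of a nonempty set; constants cannot be negative, as a fair coin shows,
    and the inequality passes to the limit, so [K_R] is itself admissible
    (rosenthal_K_R).

    When [n] is infinite, the bound passes from the finite sums to their almost
    sure limit by Fatou's lemma (pnorm_le_cvg). Finally, one of the numbers [mu]
    may be infinite while [W] is finite, if another one is zero. Then one whole
    family of variables vanishes almost surely, and so does [Q]. *)

(** * Real inequalities *)

(** Convexity of the power function, in tangent form: the graph of [x `^ q]
    lies above its tangent at [u]. This is Young's inequality for
    [x * u `^ (q - 1)]. *)
Lemma powR_tangent (R : realType) (q x u : R) :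
  1 < q -> 0 <= x -> 0 <= u ->
  u `^ q + q * u `^ (q - 1) * (x - u) <= x `^ q.
Proof.
move=> q1 x0 u0.
have q0 : 0 < q by lra.
have q10 : 0 < q - 1 by lra.
have conj : q^-1 + (q / (q - 1))^-1 = 1.
  by rewrite invf_div; field; rewrite !gt_eqF.
have := @conjugate_powR R x (u `^ (q - 1)) q (q / (q - 1)) x0 (powR_ge0 _ _) q0
  (divr_gt0 q0 q10) conj.
rewrite -powRrM (_ : (q - 1) * (q / (q - 1)) = q); last first.
  by field; rewrite gt_eqF.
rewrite -(ler_pM2l q0).
have -> : q * (x `^ q / q + u `^ q / (q / (q - 1))) = x `^ q + (q - 1) * u `^ q.
  by field; rewrite !gt_eqF.
have := mulr_powRB1 u0 q0; move: (u `^ (q - 1)) (u `^ q) => U V <-.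
by nra.
Qed.

Lemma bernoulli_powR (R : realType) (r x : R) :
  1 < r -> 0 <= x -> 1 + r * x <= (1 + x) `^ r.
Proof.
move=> r1 x0; have := powR_tangent r1 (_ : 0 <= 1 + x) ler01.
rewrite !powR1; have -> : 1 + x - 1 = x by ring.
by rewrite mulr1; apply; lra.
Qed.

(** Up to the factor [p], the derivative of [`|t| `^ p]. *)
Definition signed_power (R : realType) (p t : R) : R := t * `|t| `^ (p - 2).

Lemma norm_signed_power (R : realType) (p t : R) :
  2 < p -> `|signed_power p t| = `|t| `^ (p - 1).
Proof.
move=> p2; rewrite normrM (ger0_norm (powR_ge0 _ _)).
have -> : p - 2 = (p - 1) - 1 by ring.
by rewrite mulr_powRB1//; lra.
Qed.

Lemma ge0_signed_power (R : realType) (p t : R) :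
  2 < p -> 0 <= t -> signed_power p t = t `^ (p - 1).
Proof.
move=> p2 t0; rewrite /signed_power ger0_norm//.
have -> : p - 2 = (p - 1) - 1 by ring.
by rewrite mulr_powRB1//; lra.
Qed.

Lemma signed_powerN (R : realType) (p t : R) :
  signed_power p (- t) = - signed_power p t.
Proof. by rewrite /signed_power normrN mulNr. Qed.

(** The derivative of [signed_power p] is [(p - 1) * `|t| `^ (p - 2)]. On a
    half-line the bound follows from convexity; across the origin the two sides
    of the origin are treated separately. *)
Lemma signed_power_lipschitz (R : realType) (p M u v : R) :
  2 < p -> `|u| <= M -> `|v| <= M ->
  `|signed_power p u - signed_power p v| <= (p - 1) * M `^ (p - 2) * `|u - v|.
Proof.
move=> p2.
wlog v0 : u v / 0 <= v.
  move=> wl; have [|/ltW v0] := leP 0 v; first exact: wl.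
  move=> uM vM; have := wl (- u) (- v); rewrite !signed_powerN -!opprD !normrN.
  by rewrite oppr_ge0; exact.
wlog uv : u v v0 / u <= v.
  move=> wl uM vM; have [uv|/ltW vu] := leP u v; first exact: wl.
  rewrite distrC (distrC u); apply: wl => //; exact: le_trans vu.
move=> uM vM.
have M0 : 0 <= M by exact: le_trans (normr_ge0 u) uM.
have p11 : 1 < p - 1 by lra.
have e : p - 1 - 1 = p - 2 by ring.
rewrite distrC (distrC u) (ger0_norm (_ : 0 <= v - u)) ?subr_ge0//.
have le_M t : 0 <= t -> t <= M -> t `^ (p - 2) <= M `^ (p - 2).
  by move=> t0 tM; apply: ge0_ler_powR; rewrite ?nnegrE//; lra.
have vM' : v `^ (p - 2) <= M `^ (p - 2).
  by apply: le_M => //; rewrite ger0_norm in vM.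
have [u0|/ltW u0] := leP 0 u.
  rewrite !ge0_signed_power// ger0_norm; last first.
    by rewrite subr_ge0; apply: ge0_ler_powR; rewrite ?nnegrE//; lra.
  have := powR_tangent p11 u0 v0; rewrite e => h.
  apply: (@le_trans _ _ ((p - 1) * v `^ (p - 2) * (v - u))); first by nra.
  by rewrite ler_wpM2r ?subr_ge0// ler_wpM2l//; lra.
rewrite -(opprK u) signed_powerN.
rewrite !ge0_signed_power// ?oppr_ge0// !opprK ger0_norm ?addr_ge0 ?powR_ge0//.
have step t : 0 <= t -> t <= M -> t `^ (p - 1) <= (p - 1) * M `^ (p - 2) * t.
  move=> t0 tM; rewrite -(@mulr_powRB1 _ t (p - 1))// ?e; last by lra.
  rewrite mulrC ler_wpM2r// (le_trans (le_M _ t0 tM))// ler_peMl ?powR_ge0//.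
  by lra.
rewrite mulrDr lerD//; apply: step => //; first by rewrite ger0_norm in vM.
  by rewrite oppr_ge0.
by rewrite ler0_norm in uM.
Qed.

(** The second-order Taylor estimate for [`|x| `^ p] on which everything rests.
    Convexity bounds the increment by the derivative at the endpoint [x + y],
    and the derivative is Lipschitz on the segment from [x] to [x + y]. *)
Lemma powR_taylor (R : realType) (p x y : R) : 2 < p ->
  `|x + y| `^ p <= `|x| `^ p + p * signed_power p x * y
                   + p * (p - 1) * (`|x| + `|y|) `^ (p - 2) * y ^+ 2.
Proof.
move=> p2; pose u := x + y.
have lip : `|signed_power p u - signed_power p x| <=
    (p - 1) * (`|x| + `|y|) `^ (p - 2) * `|y|.
  rewrite (_ : y = u - x); last by rewrite /u; ring.
  apply: signed_power_lipschitz => //; last by rewrite lerDl.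
  by rewrite -{1}(subrKC x u) ler_normD.
have p0 : 0 < p by lra.
  have ue t : `|t| `^ p = signed_power p t * t.
    rewrite /signed_power mulrAC -expr2 -real_normK ?num_real// expr2 -mulrA.
    have -> : p - 2 = (p - 1) - 1 by ring.
    by rewrite !mulr_powRB1//; lra.
  have cvx : `|u| `^ p <= `|x| `^ p + p * signed_power p u * y.
    have := @powR_tangent _ p `|x| `|u| _ (normr_ge0 _) (normr_ge0 _).
    rewrite -(norm_signed_power u p2) => h'; have {h'} := h' ltac:(lra).
    rewrite (ue u) => h.
    have h2 : `|signed_power p u| * `|u| = signed_power p u * u.
      by rewrite -normrM ger0_norm// -ue powR_ge0.
    have h3 : signed_power p u * x <= `|signed_power p u| * `|x|.
      by rewrite -normrM ler_norm.
    have h4 : y = u - x by rewrite /u; ring.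
    rewrite h4; have := ler_wpM2l (ltW p0) h3.
    move: h; rewrite mulrBr -(mulrA p _ `|u|) h2.
    by lra.
  have : signed_power p u * y <= signed_power p x * y
      + (p - 1) * (`|x| + `|y|) `^ (p - 2) * y ^+ 2.
    rewrite -[y ^+ 2]real_normK ?num_real// expr2 mulrA.
    apply: (@le_trans _ _ (signed_power p x * y +
       `|signed_power p u - signed_power p x| * `|y|)); last first.
      by rewrite lerD2l ler_wpM2r.
    by rewrite -normrM -lerBlDl -mulrBl ler_norm.
  rewrite -(ler_pM2l p0) => h; rewrite -/u (le_trans cvx)//.
  by move: h; lra.
Qed.

Lemma ln_sqrt_bound (R : realType) (p : R) :
  2 < p -> Num.sqrt (8 * p) <= 6 * (p / ln p).
Proof.
move=> p2; have p0 : 0 < p by lra.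
have lp : 0 < ln p by apply: ln_gt0; lra.
rewrite mulrA ler_pdivlMr//.
have s0 : 0 < Num.sqrt p by rewrite sqrtr_gt0.
have sp : Num.sqrt p ^+ 2 = p by rewrite sqr_sqrtr// ltW.
have ln2 : ln p <= 2 * Num.sqrt p.
  (* [ln p] is twice the logarithm of [Num.sqrt p]. *)
  rewrite -{1}sp lnXn// -[_ *+ 2]mulr_natl.
  by have := ln_sublinear s0; lra.
rewrite sqrtrM; last lra.
have s8 : Num.sqrt 8 <= 3 :> R.
  by rewrite -(@ger0_norm _ 3) -?sqrtr_sqr ?ler_sqrt; lra.
have s80 := sqrtr_ge0 (8 : R).
apply: (@le_trans _ _ (3 * Num.sqrt p * (2 * Num.sqrt p))); last by nra.
apply: ler_pM => //; first exact: ltW.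
by rewrite ler_wpM2r// ltW.
Qed.

(** The lower bound is read off at [p = 4], where [ln p / ln (p / 2) = 2]. For it
    to be a lower bound of the supremum, the set must also be bounded above: the
    three factors of [Os p / (p / ln p)] that depend on [p] are controlled by
    [1 + p / 4 <= expR (p / 4)], [ln p <= p] and [p <= (p / 2) ^+ 2]. *)
Lemma K_Os_ge8 (R : realType) : 8 <= K_Os R.
Proof.
have lnd (p : R) : 4 <= p -> ln p / ln (p / 2) <= 2.
  move=> p4; rewrite ler_pdivrMr; last by apply: ln_gt0; lra.
  rewrite mulr_natl -lnXn; last by lra.
  by rewrite ler_ln ?posrE; [nra|lra|apply: exprn_gt0; lra].
have OsE (p : R) : 4 <= p -> Os p / (p / ln p) =
    4 * Num.sqrt 2 * (p / 4 + 1) `^ p^-1 * (ln p / p + ln p / ln (p / 2)).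
  move=> p4; rewrite /Os; field.
  by rewrite !gt_eqF//; [apply: ln_gt0; lra|lra|apply: ln_gt0; lra].
have s20 := sqrtr_ge0 (2 : R).
apply: (@le_trans _ _ (Os 4 / (4 / ln 4))).
  have l40 : 0 <= ln 4 / 4 :> R by rewrite divr_ge0// ln_ge0//; lra.
  have -> := OsE 4 (lexx _).
  have -> : ln 4 / ln (4 / 2) = 2 :> R.
    have -> : (4 / 2 : R) = 2 by field.
    have -> : (4 : R) = 2 ^+ 2 by ring.
    by rewrite lnXn// -[_ *+ 2]mulr_natl mulfK// gt_eqF// ln_gt0//; lra.
  have s2 : 1 <= Num.sqrt 2 :> R by rewrite -[leLHS]sqrtr1 ler_sqrt; lra.
  have -> : (4 / 4 : R) = 1 by field.
  have e1 : 1 <= (1 + 1 : R) `^ 4^-1.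
    rewrite -[leLHS](powRr0 (1 + 1 : R)) ler_powR//; lra.
  have : 1 <= Num.sqrt 2 * (1 + 1 : R) `^ 4^-1 by rewrite mulr_ege1.
  by rewrite -[4 * _ * _]mulrA; nra.
rewrite /K_Os; apply: sup_upper_bound; last by exists 4; rewrite //= lexx.
split; first by exists (Os 4 / (4 / ln 4)), 4; rewrite //= lexx.
exists (4 * Num.sqrt 2 * expR 4^-1 * (1 + 2)) => _ [p /= p4 <-].
have p0 : 0 < p by lra.
rewrite OsE//; apply: ler_pM.
- by rewrite mulr_ge0// ?powR_ge0// mulr_ge0.
- rewrite addr_ge0// divr_ge0// ?ln_ge0//; lra.
- rewrite ler_wpM2l// ?mulr_ge0//.
  have e4 : 4^-1 = (p / 4) * p^-1 :> R by field; rewrite gt_eqF.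
  rewrite [in expR _]e4 expRM; apply: ge0_ler_powR; rewrite ?nnegrE ?expR_ge0 ?invr_ge0//; try lra.
  by rewrite addrC expR_ge1Dx.
- rewrite lerD ?lnd// ler_pdivrMr// mul1r ltW// ln_sublinear//.
Qed.

(** * Expectations of products of independent variables *)

Section independent_pair.
Context {disp disp1 disp2 : measure_display} {T : measurableType disp}
  {T1 : measurableType disp1} {T2 : measurableType disp2} {R : realType}
  (P : probability T R).
Variables (Y : {mfun T >-> T1}) (X : {mfun T >-> T2}).

Definition independent_pair : Prop := forall A B, measurable A -> measurable B ->
  P (Y @^-1` A `&` X @^-1` B) = (P (Y @^-1` A) * P (X @^-1` B))%E.

Hypothesis YX : independent_pair.

Let YXm : T -> T1 * T2 := fun w => (Y w, X w).

Let measurable_YXm : measurable_fun setT YXm.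
Proof. exact: measurable_fun_pair. Qed.

Let YXmfun : {mfun T >-> (T1 * T2)%type} :=
  HB.pack YXm (isMeasurableFun.Build _ _ _ _ _ measurable_YXm).

(** By independence, the joint law of [Y] and [X] is the product of their laws,
    so expectations of functions of both can be computed by Fubini's theorem. *)
Let joint_lawE D : measurable D ->
  distribution P YXmfun D = (distribution P Y \x distribution P X)%E D.
Proof.
by move=> mD; apply/esym; apply: product_measure_unique => // A B mA mB; exact: YX.
Qed.

Let measurable_prod_fun (f : T1 -> R) (g : T2 -> R) :
  measurable_fun setT f -> measurable_fun setT g ->
  measurable_fun setT (fun z : T1 * T2 => (f z.1 * g z.2)%:E).
Proof.
move=> mf mg; apply/measurable_EFinP/measurable_funM.
  by apply: (measurableT_comp mf); exact: measurable_fst.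
by apply: (measurableT_comp mg); exact: measurable_snd.
Qed.

Lemma ge0_expectation_prod (f : T1 -> R) (g : T2 -> R) :
  measurable_fun setT f -> measurable_fun setT g ->
  (forall y, 0 <= f y) -> (forall x, 0 <= g x) ->
  (\int[P]_w (f (Y w) * g (X w))%:E =
   \int[P]_w (f (Y w))%:E * \int[P]_w (g (X w))%:E)%E.
Proof.
move=> mf mg f0 g0.
pose F (z : T1 * T2) := (f z.1 * g z.2)%:E.
have mF : measurable_fun setT F by exact: measurable_prod_fun.
have F0 z : (0 <= F z)%E by rewrite lee_fin mulr_ge0.
transitivity (\int[distribution P YXmfun]_z F z)%E.
  by rewrite ge0_integral_distribution.
rewrite (eq_measure_integral (distribution P Y \x distribution P X)%E);
  last by move=> D mD _; exact: joint_lawE.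
rewrite fubini_tonelli1// /fubini_F /F /=.
under eq_integral do under eq_integral do rewrite EFinM.
under eq_integral => y _.
  rewrite ge0_integralZl//; last 3 first.
  - exact/measurable_EFinP.
  - by move=> x _; rewrite lee_fin.
  - by rewrite lee_fin.
  over.
rewrite ge0_integralZr//; last 3 first.
- exact/measurable_EFinP.
- by move=> y _; rewrite lee_fin.
- by apply: integral_ge0 => x _; rewrite lee_fin.
by congr (_ * _)%E; rewrite ge0_integral_distribution//;
  try exact/measurable_EFinP; move=> ?; rewrite lee_fin.
Qed.

Lemma integrable_prod_independent (f : T1 -> R) (g : T2 -> R) :
  measurable_fun setT f -> measurable_fun setT g ->
  P.-integrable setT (fun w => (f (Y w))%:E) ->
  P.-integrable setT (fun w => (g (X w))%:E) ->
  P.-integrable setT (fun w => (f (Y w) * g (X w))%:E).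
Proof.
move=> mf mg /integrableP[_ intf] /integrableP[_ intX]; apply/integrableP; split.
  by apply/measurable_EFinP/measurable_funM => //; exact: measurableT_comp.
under eq_integral do rewrite abse_EFin normrM.
rewrite (@ge0_expectation_prod (fun y => `|f y|) (fun x => `|g x|))//.
- by apply: lte_mul_pinfty intX; [exact: integral_ge0 | rewrite ge0_fin_numE// integral_ge0].
- exact: measurableT_comp.
- exact: measurableT_comp.
Qed.

(** Integrating first in the centered variable gives 0. *)
Lemma centered_prod_independent (f : T1 -> R) (g : T2 -> R) :
  measurable_fun setT f -> measurable_fun setT g ->
  P.-integrable setT (fun w => (f (Y w))%:E) ->
  P.-integrable setT (fun w => (g (X w))%:E) ->
  (\int[P]_w (g (X w))%:E = 0)%E ->
  (\int[P]_w (f (Y w) * g (X w))%:E = 0)%E.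
Proof.
move=> mf mg intf intX EX0.
pose F (z : T1 * T2) := (f z.1 * g z.2)%:E.
have mF : measurable_fun setT F by exact: measurable_prod_fun.
have intF : P.-integrable setT (F \o YXmfun) by exact: integrable_prod_independent.
transitivity (\int[distribution P YXmfun]_z F z)%E.
  by rewrite integral_distribution.
have eqI (h : T1 * T2 -> \bar R) : (\int[distribution P YXmfun]_z h z =
    \int[distribution P Y \x distribution P X]_z h z)%E.
  by apply: eq_measure_integral => D mD _; exact: joint_lawE.
have intF' : (distribution P Y \x distribution P X)%E.-integrable setT F.
  apply/integrableP; split=> //; rewrite -eqI.
  have /integrableP[] // : (distribution P YXmfun).-integrable setT F.
  exact: integrable_pushforward.
rewrite eqI -integral12_prod_meas1// /fubini_F /F /=.
rewrite (eq_integral (cst 0%E)) ?integral0// => y _.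
under eq_integral do rewrite EFinM.
have mg' : measurable_fun setT (EFin \o g) by exact/measurable_EFinP.
rewrite integralZl//; last exact: integrable_pushforward.
by rewrite integral_distribution//= EX0 mule0.
Qed.

End independent_pair.

Lemma expR1_le4 (R : realType) : expR 1 <= 4 :> R.
Proof.
have h : expR (2^-1) <= 2 :> R.
  rewrite -[leRHS]invrK -[expR _]invrK lef_pV2 ?posrE ?invr_gt0 ?expR_gt0//.
  by rewrite -expRN; have := expR_ge1Dx (- 2^-1 : R); lra.
have -> : (1 : R) = 2^-1 + 2^-1 by field.
rewrite expRD; have := expR_ge0 (2^-1 : R); nra.
Qed.

(** With [t = b / a <= 1 / p] the claim reads
    [1 + p (p - 1) (1 + t) ^ (p - 2) t ^ 2 <= (1 + 8 p t ^ 2) ^ (p / 2)]: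
    the left side is at most [1 + 4 p ^ 2 t ^ 2] because
    [(1 + 1 / p) ^ p <= e <= 4], and so is Bernoulli's lower bound for the
    right side. *)
Lemma moment_recursion (R : realType) (p a b : R) :
  2 < p -> 0 < a -> 0 <= b -> p * b <= a ->
  a `^ p + p * (p - 1) * ((a + b) `^ (p - 2) * b ^+ 2) <=
  Num.sqrt (a ^+ 2 + 8 * p * b ^+ 2) `^ p.
Proof.
move=> p2 a0 b0 pba; have p0 : 0 < p by lra.
pose t := b / a; have t0 : 0 <= t by rewrite divr_ge0// ltW.
have bE : b = a * t by rewrite /t mulrC divfK// gt_eqF.
have pt : p * t <= 1 by rewrite /t mulrA ler_pdivrMr// mul1r.
have st0 : 0 <= 1 + 8 * p * t ^+ 2 by have := sqr_ge0 t; nra.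
have -> : a ^+ 2 + 8 * p * b ^+ 2 = a ^+ 2 * (1 + 8 * p * t ^+ 2).
  by rewrite bE; ring.
rewrite sqrtrM ?sqr_ge0// sqrtr_sqr ger0_norm ?(ltW a0)//.
rewrite powRM ?sqrtr_ge0// ?(ltW a0)// -powR12_sqrt// -powRrM.
have -> : a + b = a * (1 + t) by rewrite bE; ring.
rewrite powRM ?(ltW a0)//; last lra.
have apE : a `^ p = a `^ (p - 2) * a ^+ 2.
  rewrite -(powR_mulrn 2 (ltW a0)) -powRD ?subrK//.
  by apply/implyP; rewrite gt_eqF.
have -> : a `^ p + p * (p - 1) * (a `^ (p - 2) * (1 + t) `^ (p - 2) * b ^+ 2) =
    a `^ p * (1 + p * (p - 1) * ((1 + t) `^ (p - 2) * t ^+ 2)).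
  by rewrite apE bE; ring.
rewrite ler_wpM2l ?powR_ge0//.
have e4 : (1 + t) `^ (p - 2) <= 4.
  apply: le_trans (expR1_le4 R).
  apply: (@le_trans _ _ ((1 + t) `^ p)); first by rewrite ler_powR; lra.
  apply: (@le_trans _ _ (expR t `^ p)).
    by apply: ge0_ler_powR; rewrite ?nnegrE ?expR_ge0 ?expR_ge1Dx//; lra.
  by rewrite -expRM ler_expR mulrC.
have p12 : 1 < 2^-1 * p by lra.
have x0 : 0 <= 8 * p * t ^+ 2 by have := sqr_ge0 t; nra.
apply: le_trans (bernoulli_powR p12 x0).
rewrite lerD2l.
apply: (@le_trans _ _ (p * (p - 1) * (4 * t ^+ 2))).
  by rewrite ler_wpM2l ?ler_wpM2r ?sqr_ge0// mulr_ge0; lra.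
by have := sqr_ge0 t; nra.
Qed.

(** * Moments and norms *)

Lemma measurable_norm_powR {disp : measure_display} {T : measurableType disp}
    {R : realType} (X : T -> R) (p : R) : measurable_fun setT X ->
  measurable_fun setT (fun w => `|X w| `^ p).
Proof.
move=> mX; apply: (@measurableT_comp _ _ _ _ _ _ (@powR R ^~ p)) => //.
exact: measurableT_comp.
Qed.

Section moments.
Context {disp : measure_display} {T : measurableType disp} {R : realType}
  (P : probability T R).
Local Open Scope ereal_scope.
Implicit Types (X Y : T -> R) (p a b : R).

(** Bounds on norms are stated as comparisons with a real number: they then imply
    finiteness, and translate into bounds on integrals. *)
Lemma pnorm_le_moment p a X : (0 < p)%R -> (0 <= a)%R ->
  (pnorm P p X <= a%:E) <-> (\int[P]_w (`|X w| `^ p)%:E <= (a `^ p)%:E).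
Proof.
move=> p0 a0.
have -> : \int[P]_w (`|X w| `^ p)%:E = pnorm P p X `^ p.
  by rewrite /pnorm poweR_Lnorm ?gt_eqF.
have N0 : 0 <= pnorm P p X by exact: Lnorm_ge0.
rewrite -poweR_EFin; split => h.
  by apply: gt0_ler_poweR; rewrite ?in_itv/= ?lee_fin ?N0 ?a0 ?leey// ltW.
rewrite -(poweRe1 N0) -(@poweRe1 _ a%:E)// -(@divff _ p) ?gt_eqF// !poweRrM.
apply: gt0_ler_poweR h; rewrite ?in_itv/= ?poweR_ge0 ?leey//.
  by rewrite invr_ge0 ltW.
by rewrite lee_fin powR_ge0.
Qed.

Lemma pnorm0 p X : (0 < p)%R -> (forall w, X w = 0%R) ->
  pnorm P p X = 0.
Proof.
move=> p0 X0; rewrite /pnorm.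
have -> : EFin \o X = cst 0%E by apply/funext => w; rewrite /= X0.
by rewrite Lnorm0// gt_eqF// lte_fin.
Qed.

Lemma integrable_moment p a X : measurable_fun setT X -> (0 < p)%R ->
  (0 <= a)%R -> pnorm P p X <= a%:E ->
  P.-integrable setT (fun w => (`|X w| `^ p)%:E).
Proof.
move=> mX p0 a0 /(pnorm_le_moment X p0 a0) h; apply/integrableP; split.
  by apply/measurable_EFinP; exact: measurable_norm_powR.
under eq_integral do rewrite abse_EFin ger0_norm ?powR_ge0//.
exact: le_lt_trans h (ltry _).
Qed.

Lemma pnorm_norm p X : pnorm P p (fun w => `|X w|%R) = pnorm P p X.
Proof. by rewrite /pnorm -[RHS]Lnorm_abse. Qed.

Lemma pnorm_powR_le p a r X : (0 < p)%R -> (0 < r)%R -> (0 <= a)%R ->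
  pnorm P p X <= a%:E -> pnorm P (p / r)%R (fun w => `|X w| `^ r)%R <= (a `^ r)%:E.
Proof.
move=> p0 r0 a0 /(pnorm_le_moment X p0 a0) h.
apply/pnorm_le_moment; rewrite ?powR_ge0 ?divr_gt0//.
have e x : (0 <= x -> (x `^ r) `^ (p / r) = x `^ p :> R)%R.
  by move=> x0; rewrite -powRrM; congr (powR _ _); field; rewrite gt_eqF.
rewrite e//; apply: le_trans h; rewrite le_eqVlt; apply/orP; left; apply/eqP.
by apply: eq_integral => w _; rewrite ger0_norm ?powR_ge0// e.
Qed.

Lemma pnorm_prod_le {disp1 disp2 : measure_display} {T1 : measurableType disp1}
  {T2 : measurableType disp2} (Y : {mfun T >-> T1}) (X : {mfun T >-> T2})
  (f : T1 -> R) (g : T2 -> R) p a b :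
  independent_pair P Y X -> measurable_fun setT f -> measurable_fun setT g ->
  (0 < p)%R -> (0 <= a)%R -> (0 <= b)%R ->
  pnorm P p (f \o Y) <= a%:E -> pnorm P p (g \o X) <= b%:E ->
  pnorm P p (fun w => f (Y w) * g (X w))%R <= (a * b)%:E.
Proof.
move=> YX mf mg p0 a0 b0 /pnorm_le_moment fa /pnorm_le_moment gb.
apply/pnorm_le_moment; rewrite ?mulr_ge0//.
under eq_integral do rewrite normrM powRM//.
rewrite (@ge0_expectation_prod _ _ _ _ _ _ _ P Y X YX
  (fun y => `|f y| `^ p)%R (fun x => `|g x| `^ p)%R); last 4 first.
- exact: measurable_norm_powR.
- exact: measurable_norm_powR.
- by move=> y; exact: powR_ge0.
- by move=> y; exact: powR_ge0.
rewrite powRM// EFinM; apply: lee_pmul; [| |exact: fa|exact: gb].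
- by apply: integral_ge0 => w _; rewrite lee_fin powR_ge0.
- by apply: integral_ge0 => w _; rewrite lee_fin powR_ge0.
Qed.

Lemma pnorm_add_le p a b X Y : measurable_fun setT X -> measurable_fun setT Y ->
  (1 <= p)%R -> pnorm P p X <= a%:E -> pnorm P p Y <= b%:E ->
  pnorm P p (fun w => X w + Y w)%R <= (a + b)%:E.
Proof.
move=> mX mY p1 Xa Yb; rewrite EFinD.
by apply: le_trans (leeD Xa Yb); exact: minkowski_EFin.
Qed.

(** Hoelder's inequality with exponents [p / (p - 2)] and [p / 2]. *)
Lemma hoelder_second_order p a b X Y :
  measurable_fun setT X -> measurable_fun setT Y -> (2 < p)%R ->
  (0 <= a)%R -> (0 <= b)%R -> pnorm P p X <= a%:E -> pnorm P p Y <= b%:E ->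
  \int[P]_w (`|X w| `^ (p - 2) * Y w ^+ 2)%:E <= (a `^ (p - 2) * b ^+ 2)%:E.
Proof.
move=> mX mY p2 a0 b0 Xa Yb.
have sqr (x : R) : (x ^+ 2 = `|x| `^ 2)%R.
  by rewrite powR_mulrn// real_normK ?num_real.
have p0 : (0 < p)%R by lra.
have r0 : (0 < p - 2)%R by lra.
have hX := pnorm_powR_le p0 r0 a0 Xa.
have hY := pnorm_powR_le p0 (ltr0n R 2) b0 Yb.
rewrite sqr ger0_norm//.
have m1 : measurable_fun setT (fun w => `|X w| `^ (p - 2))%R.
  exact: measurable_norm_powR.
have m2 : measurable_fun setT (fun w => `|Y w| `^ 2)%R.
  exact: measurable_norm_powR.
have := @hoelder _ _ _ P _ _ (p / (p - 2))%R (p / 2)%R m1 m2.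
rewrite !divr_gt0// => /(_ isT isT) h.
apply: le_trans (lee_pmul (Lnorm_ge0 _ _ _) (Lnorm_ge0 _ _ _) hX hY).
apply: le_trans (h _); last by field; rewrite !gt_eqF.
rewrite Lnorm1 le_eqVlt; apply/orP; left; apply/eqP.
apply: eq_integral => w _; rewrite /= sqr.
by rewrite (ger0_norm (mulr_ge0 (powR_ge0 _ _) (powR_ge0 _ _))).
Qed.

End moments.

(** * The Pythagorean inequality for one increment *)

Section orthogonal_increment.
Context {disp disp1 : measure_display} {T : measurableType disp}
  {T1 : measurableType disp1} {R : realType} (P : probability T R).
Variables (Y : {mfun T >-> T1}) (X : {RV P >-> R}) (f g : T1 -> R) (p a c m : R).
Hypotheses (YX : independent_pair P Y X) (X_centered : centered X)
  (mf : measurable_fun setT f) (mg : measurable_fun setT g)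
  (p_gt2 : 2 < p) (a_ge0 : 0 <= a) (c_ge0 : 0 <= c) (m_ge0 : 0 <= m)
  (f_a : (pnorm P p (f \o Y) <= a%:E)%E) (g_c : (pnorm P p (g \o Y) <= c%:E)%E)
  (X_m : (pnorm P p X <= m%:E)%E).

Let A w := f (Y w).
Let D w := g (Y w) * X w.

Let measurable_A : measurable_fun setT A.
Proof. exact: measurableT_comp. Qed.

Let measurable_D : measurable_fun setT D.
Proof. by apply: measurable_funM => //; exact: measurableT_comp. Qed.

Let p_gt0 : 0 < p.
Proof. exact: lt_trans p_gt2. Qed.

Let D_cm : (pnorm P p D <= (c * m)%:E)%E.
Proof. by apply: (@pnorm_prod_le _ _ _ P _ _ _ _ Y X g id). Qed.

(** The first-order Taylor term [signed_power p A * D] is a function of [Y]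
    times the independent centered variable [X]. Its integrability is Young's
    inequality [x ^ (p - 1) y <= x ^ p + y ^ p]. *)
Let integrable_signed_power : P.-integrable setT
  (fun w => (signed_power p (f (Y w)) * g (Y w))%:E).
Proof.
apply: (@le_integrable _ _ _ _ _ measurableT _
  (fun w => (`|A w| `^ p)%:E + (`|g (Y w)| `^ p)%:E)%E).
- apply/measurable_EFinP/measurable_funM; last exact: measurableT_comp.
  by apply: measurable_funM => //; exact: measurable_norm_powR.
- move=> w _; rewrite -EFinD !abse_EFin lee_fin.
  rewrite [leRHS]ger0_norm ?addr_ge0 ?powR_ge0// normrM norm_signed_power//.
  rewrite -/(A w); set x := `|A w|; set y := `|g (Y w)|.
  have x0 : 0 <= x by exact: normr_ge0.
  have y0 : 0 <= y by exact: normr_ge0.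
  have [xy|/ltW yx] := leP x y.
    apply: (@le_trans _ _ (y `^ p)); last by rewrite lerDr powR_ge0.
    rewrite -(mulr_powRB1 y0 p_gt0) mulrC ler_wpM2l//.
    by apply: ge0_ler_powR; rewrite ?nnegrE//; have := p_gt2; lra.
  apply: (@le_trans _ _ (x `^ p)); last by rewrite lerDl powR_ge0.
  by rewrite -(mulr_powRB1 x0 p_gt0) mulrC ler_wpM2r// powR_ge0.
- apply: integrableD => //; first exact: (integrable_moment _ _ _ f_a).
  by apply: (integrable_moment _ _ _ g_c) => //; exact: measurableT_comp.
Qed.

Let S w := `|A w| + `|D w|.

Let measurable_S : measurable_fun setT S.
Proof. by apply: measurable_funD; exact: measurableT_comp. Qed.

Let S_le : (pnorm P p S <= (a + c * m)%:E)%E.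
Proof.
apply: pnorm_add_le; rewrite ?pnorm_norm//; try exact: measurableT_comp.
by have := p_gt2; lra.
Qed.

Let second_order_le :
  (\int[P]_w (S w `^ (p - 2) * D w ^+ 2)%:E <=
   ((a + c * m) `^ (p - 2) * (c * m) ^+ 2)%:E)%E.
Proof.
have s0 : 0 <= a + c * m by rewrite addr_ge0// mulr_ge0.
apply: le_trans (hoelder_second_order measurable_S measurable_D p_gt2 s0
  (mulr_ge0 c_ge0 m_ge0) S_le D_cm).
rewrite le_eqVlt; apply/orP; left; apply/eqP; apply: eq_integral => w _.
by rewrite (ger0_norm (addr_ge0 (normr_ge0 _) (normr_ge0 _))).
Qed.

Let moment_le :
  (\int[P]_w (`|(A w + D w)%R| `^ p)%:E <=
   (a `^ p + p * (p - 1) * ((a + c * m) `^ (p - 2) * (c * m) ^+ 2))%:E)%E.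
Proof.
pose h1 w := (`|A w| `^ p)%:E.
pose h2 w := (p%:E * ((signed_power p (f (Y w)) * g (Y w)) * X w)%:E)%E.
pose h3 w := ((p * (p - 1))%:E * (S w `^ (p - 2) * D w ^+ 2)%:E)%E.
have pp0 : 0 <= p * (p - 1) by rewrite mulr_ge0//; have := p_gt2; lra.
have mh3 : measurable_fun setT (fun w => (S w `^ (p - 2) * D w ^+ 2)%:E).
  apply/measurable_EFinP/measurable_funM; last exact: measurable_funX.
  exact: (@measurableT_comp _ _ _ _ _ _ (@powR R ^~ (p - 2))).
have ih1 : P.-integrable setT h1 by exact: (integrable_moment _ _ _ f_a).
have msg : measurable_fun setT (fun y => signed_power p (f y) * g y).
  apply: measurable_funM => //.
  by apply: measurable_funM => //; exact: measurable_norm_powR.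
have ih2' : P.-integrable setT
    (fun w => ((signed_power p (f (Y w)) * g (Y w)) * X w)%:E).
  apply: (@integrable_prod_independent _ _ _ _ _ _ _ P Y X YX
    (fun y => signed_power p (f y) * g y) id) => //.
  by case: X_centered.
have ih2 : P.-integrable setT h2 by exact: integrableZl.
have ih3' : P.-integrable setT (fun w => (S w `^ (p - 2) * D w ^+ 2)%:E).
  apply/integrableP; split=> //.
  under eq_integral do
    rewrite abse_EFin (ger0_norm (mulr_ge0 (powR_ge0 _ _) (sqr_ge0 _))).
  exact: le_lt_trans second_order_le (ltry _).
have ih3 : P.-integrable setT h3 by exact: integrableZl.
have ih12 : P.-integrable setT (h1 \+ h2)%E by exact: integrableD.
apply: (@le_trans _ _ (\int[P]_w ((h1 w + h2 w) + h3 w))%E).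
  apply: ge0_le_integral => //.
  - by apply/measurable_EFinP/measurable_norm_powR/measurable_funD.
  - by have /integrableP[] := integrableD measurableT ih12 ih3.
  - move=> w _; rewrite /h1 /h2 /h3 -!EFinM -!EFinD lee_fin.
    have := powR_taylor (A w) (D w) p_gt2.
    by rewrite !mulrA.
rewrite integralD//= integralD//= [X in (_ + X + _)%E](_ : _ = 0%E); last first.
  rewrite integralZl// (@centered_prod_independent _ _ _ _ _ _ _ P Y X YX
    (fun y => signed_power p (f y) * g y) id) ?mule0//; first by case: X_centered.
  by case: X_centered => _; rewrite unlock.
rewrite adde0 integralZl// EFinD (EFinM (p * (p - 1))); apply: leeD.
  exact/(pnorm_le_moment P _ p_gt0 a_ge0).
by apply: lee_wpmul2l; rewrite ?lee_fin.
Qed.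

(** A martingale version of the Pythagorean theorem. If [D] is small compared to
    [A], Taylor's formula for the [p]-th moment applies, its first-order term
    having mean zero; otherwise Minkowski's inequality is already enough. *)
Lemma pnorm_add_orthogonal :
  (pnorm P p (fun w => f (Y w) + g (Y w) * X w)%R <=
   (Num.sqrt (a ^+ 2 + 8 * p * (c * m) ^+ 2))%:E)%E.
Proof.
have b0 : 0 <= c * m by rewrite mulr_ge0.
have [small|large] := ltP (p * (c * m)) a.
  have a_gt0 : 0 < a by apply: le_lt_trans small; rewrite mulr_ge0// ltW.
  apply/pnorm_le_moment; rewrite ?sqrtr_ge0//.
  apply: le_trans moment_le _; rewrite lee_fin.
  by apply: moment_recursion => //; exact: ltW.
apply: (@le_trans _ _ (a + c * m)%:E).
  by apply: pnorm_add_le => //; have := p_gt2; lra.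
rewrite lee_fin -[leLHS]ger0_norm ?addr_ge0// -sqrtr_sqr.
move: (c * m) b0 large => b b0 large; rewrite ler_sqrt.
  have : a * b <= p * b * b by rewrite ler_wpM2r.
  by have := sqr_ge0 b; have := p_gt2; nra.
by rewrite addr_ge0 ?sqr_ge0// mulr_ge0 ?sqr_ge0//; have := p_gt2; lra.
Qed.

End orthogonal_increment.

(** * Sigma-algebras generated by independent families *)

Section generated_sigma_algebra.
Context {disp : measure_display} {T : measurableType disp} {R : realType}
  (P : probability T R) {I : choiceType} (X : I -> {RV P >-> R}).
Implicit Types (D E : set I).

(** The finite-dimensional cylinders of the variables indexed by [E], a
    pi-system that generates their sigma-algebra. *)
Definition cylinders E : set (set T) := [set C | exists (J : {fset I}) A,
  [/\ [set` J] `<=` E, (forall j, measurable (A j)) &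
   C = \bigcap_(j in [set` J]) (X j @^-1` A j)]].

Definition sigma_of E := g_sigma_algebraType (cylinders E).

Definition measurable_wrt E (Z : T -> R) :=
  measurable_fun [set: sigma_of E] (Z : sigma_of E -> R).

Lemma measurable_cylinders E : cylinders E `<=` measurable.
Proof.
move=> C [J [A [_ mA ->]]]; apply: fin_bigcap_measurable => //= j _.
exact: measurable_funPTI.
Qed.

Lemma setI_closed_cylinders E : setI_closed (cylinders E).
Proof.
move=> _ _ [J1 [A1 [J1E mA1 ->]]] [J2 [A2 [J2E mA2 ->]]].
pose B (J : {fset I}) (A : I -> set R) j := if j \in J then A j else setT.
exists (J1 `|` J2)%fset, (fun j => B J1 A1 j `&` B J2 A2 j); split.
- by move=> j /=; rewrite in_fsetU => /orP[/J1E|/J2E].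
- by move=> j; apply: measurableI; rewrite /B; case: ifPn.
- apply/seteqP; split => w.
    move=> [h1 h2] j /= _; split; rewrite /B; case: ifPn => //.
      exact: h1.
    exact: h2.
  move=> h; split => j /= jJ; have := h j; rewrite /= in_fsetU jJ ?orbT.
    by move=> /(_ isT)[]; rewrite /B jJ.
  by move=> /(_ isT)[]; rewrite /B jJ.
Qed.

Lemma measurable_id_sigma_of E : measurable_fun [set: T] (id : T -> sigma_of E).
Proof.
move=> _ A mA; rewrite setTI preimage_id.
by apply: (smallest_sub (@sigma_algebra_measurable _ T) _ mA);
  exact: measurable_cylinders.
Qed.

Lemma measurable_wrt_measurable E Z :
  measurable_wrt E Z -> measurable_fun setT Z.
Proof.
by move=> mZ; apply: (measurableT_comp mZ); exact: measurable_id_sigma_of.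
Qed.

Lemma measurable_wrtW D E Z : D `<=` E -> measurable_wrt D Z ->
  measurable_wrt E Z.
Proof.
move=> DE mZ _ A mA; rewrite setTI.
have := mZ measurableT A mA; rewrite setTI.
apply: sub_sigma_algebra2 => C [J [B [JD mB ->]]].
by exists J, B; split=> //; exact: subset_trans DE.
Qed.

Lemma measurable_wrt_var E i : E i -> measurable_wrt E (X i).
Proof.
move=> Ei _ A mA; rewrite setTI; apply: sub_sigma_algebra.
exists [fset i]%fset, (fun=> A); split=> //.
  by move=> j /=; rewrite in_fset1 => /eqP ->.
by rewrite set_fset1 bigcap_set1.
Qed.

Definition to_sigma_of E : {mfun T >-> sigma_of E} :=
  HB.pack (id : T -> sigma_of E)
    (isMeasurableFun.Build _ _ _ _ _ (@measurable_id_sigma_of E)).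

(** The measures [A |-> P (A n C)] and [A |-> P (A) P (C)], where [C] is an
    event on [X i], agree on the cylinders, hence on the sigma-algebra. *)
Lemma independent_sigma_of D E i : mutually_independent D X -> E `<=` D ->
  D i -> ~ E i -> independent_pair P (to_sigma_of E) (X i).
Proof.
move=> indep ED Di Ei A B mA mB; rewrite /= preimage_id.
have mC : measurable (X i @^-1` B) by exact: measurable_funPTI.
pose m1 : {measure set T -> \bar R} := mrestr P mC.
have PC : P (X i @^-1` B) = (fine (P (X i @^-1` B)))%:E.
  by rewrite fineK// fin_num_measure.
pose r : {nonneg R} := NngNum (fine_ge0 (measure_ge0 P (X i @^-1` B))).
pose m2 : {measure set T -> \bar R} := mscale r P.
have m2E F : m2 F = (P F * P (X i @^-1` B))%E by rewrite PC muleC.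
rewrite -m2E; change (m1 A = m2 A).
apply: (@g_sigma_algebra_measure_unique _ _ _ (cylinders E) _ (fun=> setT)) => //.
- exact: measurable_cylinders.
- move=> _; exists fset0, (fun=> setT); split=> //.
  by rewrite set_fset0 bigcap_set0.
- by rewrite bigcup_const.
- exact: setI_closed_cylinders.
- move=> _ [J [F [JE mF ->]]]; rewrite m2E.
  have iJ : i \notin J by apply/negP => /JE.
  pose G j := if j == i then B else F j.
  have mG j : measurable (G j) by rewrite /G; case: ifPn.
  have GF j : j \in J -> G j = F j.
    by rewrite /G; case: eqP => // -> h; rewrite h in iJ.
  transitivity (P (\bigcap_(j in [set` (i |` J)%fset]) (X j @^-1` G j))).
    congr (P _); apply/seteqP; split => w.
      move=> [hJ hi] j /=; rewrite in_fset1U => /predU1P[->|jJ].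
        by rewrite /G eqxx.
      by rewrite GF//; exact: hJ.
    move=> h; split.
      move=> j jJ /=; rewrite -GF//; apply: h; rewrite /= in_fset1U.
      by rewrite (_ : j \in J) ?orbT.
    by have := h i; rewrite /= in_fset1U eqxx /G eqxx; apply.
  rewrite indep//; last by move=> j /=; rewrite in_fset1U => /predU1P[->//|/JE/ED].
  rewrite big_fsetU1//= {1}/G eqxx muleC; congr (_ * _)%E.
  rewrite [in RHS]indep//; last exact: subset_trans ED.
  by apply: eq_big_seq => j jJ; rewrite GF.
- move=> _; rewrite (_ : m1 setT = P (setT `&` X i @^-1` B))//.
  by rewrite setTI (le_lt_trans (probability_le1 P mC)) ?ltry.
Qed.

End generated_sigma_algebra.

(** * Sums of orthogonal increments and Rosenthal's inequality *)

Section orthogonal_sum.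
Context {disp : measure_display} {T : measurableType disp} {R : realType}
  (P : probability T R) {I : choiceType} (X : I -> {RV P >-> R}).

(** The coefficients [Z k] depend on the variables indexed by [E], and the
    variables [X (h k)] are outside of [E]. At step [N], the partial sum depends
    on [E] and on the variables [X (h k)] with [k < N], all of which are
    independent of [X (h N)]. *)
Lemma pnorm_sum_orthogonal (D E : set I) (h : nat -> I) (Z : nat -> T -> R)
    (c m : nat -> R) (p : R) (N : nat) :
  mutually_independent D X -> E `<=` D -> 2 < p ->
  (forall k, (k < N)%N -> D (h k) /\ ~ E (h k)) ->
  (forall j k, (j < k < N)%N -> h j <> h k) ->
  (forall k, (k < N)%N -> centered (X (h k))) ->
  (forall k, (k < N)%N -> measurable_wrt X E (Z k)) ->
  (forall k, 0 <= c k) -> (forall k, 0 <= m k) ->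
  (forall k, (k < N)%N -> (pnorm P p (Z k) <= (c k)%:E)%E) ->
  (forall k, (k < N)%N -> (pnorm P p (X (h k)) <= (m k)%:E)%E) ->
  (pnorm P p (fun w => \sum_(k < N) Z k w * X (h k) w)%R <=
   (Num.sqrt (8 * p * \sum_(k < N) (c k * m k) ^+ 2))%:E)%E.
Proof.
move=> indep ED p2; elim: N => [|N IH] hDE hinj X0 mZ c0 m0 Zc Xm.
  rewrite pnorm0; [|lra|by move=> w; rewrite big_ord0].
  by rewrite big_ord0 mulr0 sqrtr0.
pose F := E `|` [set h k | k in [set k | (k < N)%N]].
have FD : F `<=` D.
  by move=> i [/ED//|[k /= kN <-]]; exact: (hDE k (ltnW kN)).1.
have nF : ~ F (h N).
  move=> [|[k /= kN]]; first exact: (hDE N (ltnSn N)).2.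
  by apply: hinj; rewrite kN /=.
have mF k : (k < N)%N -> measurable_wrt X F (X (h k)).
  by move=> kN; apply: measurable_wrt_var; right; exists k.
have mZF k : (k < N.+1)%N -> measurable_wrt X F (Z k).
  by move=> kN; apply: measurable_wrtW (mZ k kN) => i; left.
have mS : measurable_wrt X F (fun w => \sum_(k < N) Z k w * X (h k) w).
  apply: measurable_sum => k; apply: measurable_funM; last exact: mF.
  exact: (mZF k (ltnW (ltn_ord k))).
have S8 : 0 <= 8 * p * \sum_(k < N) (c k * m k) ^+ 2.
  by rewrite mulr_ge0 ?sumr_ge0//; [lra|move=> *; exact: sqr_ge0].
have := @pnorm_add_orthogonal _ _ _ _ _ P (to_sigma_of X F) (X (h N)) _ (Z N) p
  (Num.sqrt (8 * p * \sum_(k < N) (c k * m k) ^+ 2)) (c N) (m N)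
  (independent_sigma_of indep FD (hDE N (ltnSn N)).1 nF) (X0 N (ltnSn N))
  mS (mZF N (ltnSn N)) p2 (sqrtr_ge0 _) (c0 N) (m0 N) _ (Zc N (ltnSn N))
  (Xm N (ltnSn N)).
rewrite sqr_sqrtr// big_ord_recr/= mulrDr => /(_ (IH _ _ _ _ _ _ _ _)).
under [X in _ -> (pnorm P p X <= _)%E]eq_fun do rewrite big_ord_recr/=.
apply => //.
- by move=> k kN; apply: hDE; exact: ltnW.
- by move=> j k /andP[jk kN]; apply: hinj; rewrite jk ltnW.
- by move=> k kN; apply: X0; exact: ltnW.
- by move=> k kN; apply: mZ; exact: ltnW.
- by move=> k kN; apply: Zc; exact: ltnW.
- by move=> k kN; apply: Xm; exact: ltnW.
Qed.

End orthogonal_sum.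

Lemma pnorm_cst1 {disp : measure_display} {T : measurableType disp}
  {R : realType} (P : probability T R) (p : R) : pnorm P p (cst 1) = 1%E.
Proof.
rewrite /pnorm (_ : EFin \o _ = cst 1%E)// Lnorm_cst1.
by rewrite -[RHS](poweR1r p^-1); congr poweR; exact: probability_setT.
Qed.

(** The coefficients being constant, they are measurable with respect to the
    variables of the empty family. *)
Lemma rosenthal_6 (R : realType) : rosenthal_inequality (6 : R).
Proof.
move=> disp T P p [//|n] xi p2 _ indep centered_xi xi_fin.
have fine_pnorm k : pnorm P p (xi k) = (fine (pnorm P p (xi k)))%:E.
  by rewrite fineK// ge0_fin_numE// Lnorm_ge0.
have := @pnorm_sum_orthogonal _ _ _ P _ xi setT set0 inord (fun=> cst 1)
  (fun=> 1) (fun k => fine (pnorm P p (xi (inord k)))) p n.+1 indep (@sub0set _ _) p2.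
have inord_inj (j k : nat) : (j < k < n.+1)%N -> @inord n j <> inord k.
  move=> /andP[jk kn] /(congr1 (@nat_of_ord _)); rewrite !inordK//; last exact: ltn_trans kn.
  by move=> e; rewrite e ltnn in jk.
move=> /(_ (fun _ _ => conj I id) inord_inj (fun k _ => centered_xi _)).
move=> /(_ (fun k _ => measurable_cst _) (fun=> ler01)).
move=> /(_ (fun k => fine_ge0 (Lnorm_ge0 _ _ _))).
move=> /(_ (fun k _ => _)) h.
have {}h := h ltac:(by rewrite pnorm_cst1).
have {}h := h ltac:(by move=> k _; rewrite -fine_pnorm).
have eS w : \sum_(k < n.+1) cst 1 w * xi (inord k) w = \sum_(k < n.+1) xi k w.
  by apply: eq_bigr => k _; rewrite mul1r inord_val.
have {}h : (pnorm P p (fun w => (\sum_(k < n.+1) xi k w)%R) <=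
    (6 * (p / ln p) * Num.sqrt (\sum_(k < n.+1) fine (pnorm P p (xi k)) ^+ 2))%:E)%E.
  rewrite -(funext eS); apply: le_trans h _; rewrite lee_fin.
  rewrite sqrtrM; last by rewrite mulr_ge0//; lra.
  have -> : \sum_(k < n.+1) (1 * fine (pnorm P p (xi (inord k)))) ^+ 2 =
    \sum_(k < n.+1) fine (pnorm P p (xi k)) ^+ 2.
    by apply: eq_bigr => k _; rewrite mul1r inord_val.
  by rewrite ler_wpM2r// ln_sqrt_bound.
rewrite sqrtrM ?invr_ge0// sqrtrV// mulrCA EFinM.
by apply: lee_wpmul2l => //; rewrite lee_fin invr_ge0.
Qed.

(** * Rosenthal's best constant *)

Definition rademacher (R : realType) (b : bool) : R := if b then 1 else -1.

Section rademacher.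
Context {R : realType}.
Let coin : probability bool R := bernoulli_prob (2^-1 : R).

Let measurable_rademacher : measurable_fun setT (rademacher R).
Proof. by []. Qed.

Definition rademacher_RV : {RV coin >-> R} :=
  HB.pack (rademacher R) (isMeasurableFun.Build _ _ _ _ _ measurable_rademacher).

Lemma centered_rademacher : centered rademacher_RV.
Proof.
have h01 : 0 <= (2^-1 : R) <= 1 by apply/andP; split; lra.
have intR : coin.-integrable setT (EFin \o rademacher_RV).
  apply/integrableP; split; first exact/measurable_EFinP.
  rewrite integral_bernoulli_prob// /rademacher/=.
  by rewrite -!EFinM -EFinD ltry.
split=> //; rewrite unlock.
have : (\int[coin]_b (rademacher R b + 1)%:E = 1)%E.
  rewrite integral_bernoulli_prob//; last first.
    by case; rewrite lee_fin /rademacher; lra.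
  by rewrite /rademacher/= /unstable.onem -!EFinM -EFinD; congr EFin; lra.
under eq_integral do rewrite EFinD.
rewrite integralD//; last first.
  by apply/integrableP; split=> //; rewrite integral_cst//= normr1 mul1e probability_setT ltry.
rewrite integral_cst//= probability_setT mule1.
by move=> /(congr1 (fun x => x - 1)%E); rewrite addeK// subee.
Qed.

Lemma pnorm_rademacher (p : R) : pnorm coin p rademacher_RV = 1%E.
Proof.
rewrite -pnorm_norm -(pnorm_cst1 coin p); congr pnorm; apply/funext => b.
by rewrite /= /rademacher; case: b; rewrite ?normrN normr1.
Qed.

End rademacher.

Lemma mutually_independent_ord1 {disp : measure_display}
    {T : measurableType disp} {R : realType} (P : probability T R)
    (X : 'I_1 -> {RV P >-> R}) : mutually_independent setT X.
Proof.
move=> J A _ mA; have [J0|J0] := boolP (ord0 \in J).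
  have -> : J = [fset ord0]%fset.
    by apply/fsetP => i; rewrite in_fset1 ord1 eqxx J0.
  by rewrite set_fset1 bigcap_set1 big_seq_fset1.
have -> : J = fset0 by apply/fsetP => i; rewrite ord1 (negbTE J0) in_fset0.
by rewrite set_fset0 bigcap_set0 big_seq_fset0 probability_setT.
Qed.

(** Rademacher's variable has all its absolute moments equal to 1, so that a constant in
    Rosenthal's inequality cannot be negative. *)
Lemma rosenthal_ge0 (R : realType) (C : R) : rosenthal_inequality C -> 0 <= C.
Proof.
move=> /(_ _ _ (bernoulli_prob (2^-1 : R)) 3 1%N (fun=> rademacher_RV)).
have n1 : pnorm (bernoulli_prob (2^-1 : R)) 3 rademacher_RV = 1%E.
  exact: pnorm_rademacher.
move=> /(_ _ isT (mutually_independent_ord1 _)) h.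
have {}h := h ltac:(by rewrite ltr_nat) (fun=> centered_rademacher).
have {h} := h ltac:(by move=> _; rewrite n1 ltry).
rewrite big_ord1 n1 /= expr1n sqrtr1 invr1 mulr1 sqrtr1 mulr1.
rewrite mul1e (_ : (fun w => _) = rademacher_RV); last first.
  by apply/funext => w; rewrite big_ord1.
rewrite n1 lee_fin => C1.
have l3 : 0 < 3 / ln 3 :> R by rewrite divr_gt0// ln_gt0// ltr1n.
by rewrite -(pmulr_lge0 _ l3) (le_trans _ C1).
Qed.

Lemma K_R_ge0 (R : realType) : 0 <= K_R R.
Proof.
apply: lb_le_inf; first by exists 6; exact: rosenthal_6.
by move=> C; exact: rosenthal_ge0.
Qed.

(** The infimum defining [K_R] is over a nonempty closed half-line. *)
Lemma rosenthal_K_R (R : realType) : rosenthal_inequality (K_R R).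
Proof.
move=> disp T P p n xi p2 n0 indep cxi xifin.
have lp : 0 < p / ln p by apply: divr_gt0; [lra|apply: ln_gt0; lra].
set L := (X in (X <= _)%E); set v := Num.sqrt _.
have LC C : rosenthal_inequality C -> (L <= (C * (p / ln p) * v)%:E)%E.
  by move=> /(_ disp T P p n xi p2 n0 indep cxi xifin).
have L6 := LC _ (@rosenthal_6 R).
have L0 : (0 <= L)%E.
  by rewrite mule_ge0 ?Lnorm_ge0// lee_fin invr_ge0.
have Lfin : L \is a fin_num by rewrite ge0_fin_numE// (le_lt_trans L6) ?ltry.
rewrite -(fineK Lfin) lee_fin.
have {}LC C : rosenthal_inequality C -> fine L <= C * ((p / ln p) * v).
  by move=> /LC LC'; rewrite mulrA -lee_fin fineK.
rewrite -mulrA.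
have v0 : 0 <= v by exact: sqrtr_ge0.
have := mulr_ge0 (ltW lp) v0; rewrite le_eqVlt => /predU1P[v1|v1].
  by have := LC _ (@rosenthal_6 R); rewrite -v1 !mulr0.
rewrite -ler_pdivrMr//; apply: lb_le_inf; first by exists 6; exact: rosenthal_6.
by move=> C /LC; rewrite ler_pdivrMr.
Qed.

(** * Recursion on the order of the chaos *)

Fixpoint increasing_tuples (d N : nat) : seq (d.-tuple nat) :=
  match d with
  | 0 => [:: [tuple]]
  | d'.+1 => [seq rcons_tuple j k | k <- iota 0 N, j <- increasing_tuples d' k]
  end.

Lemma rcons_tupleP (A : Type) (d : nat) (i : d.+1.-tuple A) :
  exists j k, i = rcons_tuple (j : d.-tuple A) k.
Proof.
case: i => s; case/lastP: s => [//|s x] sz.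
have sz' : size s == d by move: sz; rewrite size_rcons.
by exists (Tuple sz'), x; exact: val_inj.
Qed.

Lemma rcons_tuple_inj (A : Type) (d : nat) (j j' : d.-tuple A) k k' :
  rcons_tuple j k = rcons_tuple j' k' -> j = j' /\ k = k'.
Proof. by move=> /(congr1 val)/rcons_inj[/val_inj -> ->]. Qed.

Lemma mem_increasing_tuples d N (i : d.-tuple nat) :
  (i \in increasing_tuples d N) = sorted ltn i && all (below (Some N)) i.
Proof.
elim: d N i => [|d IH] N i; first by rewrite tuple0 inE eqxx.
have [j [k ->]] := rcons_tupleP i.
apply/idP/idP.
  case/allpairsPdep => k' [j' [kN' jk' /(@rcons_tuple_inj nat d)[ej ek]]].
  move: kN' jk'; rewrite -{}ej -{}ek.
  rewrite mem_iota add0n IH => /= kN /andP[].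
  rewrite !(sorted_pairwise ltn_trans) pairwise_rcons all_rcons /= => -> jk.
  rewrite jk kN/= (sub_all _ jk)// => x xk; exact: ltn_trans kN.
rewrite /= (sorted_pairwise ltn_trans) pairwise_rcons all_rcons /=.
move=> /andP[/andP[jk sj] /andP[kN _]].
apply/allpairsPdep; exists k, j; split=> //; first by rewrite mem_iota.
by rewrite IH (sorted_pairwise ltn_trans) sj.
Qed.

Lemma uniq_increasing_tuples d N : uniq (increasing_tuples d N).
Proof.
elim: d N => [|d IH] N //=; apply: allpairs_uniq_dep.
- exact: iota_uniq.
- by move=> k _; exact: IH.
- by move=> /= [k j] [k' j'] _ _ /= /(@rcons_tuple_inj nat d)[<- <-].
Qed.

Lemma fsum_multi_index (V : nmodType) d N (F : d.-tuple nat -> V) :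
  \sum_(i \in multi_index (Some N)) F i = \sum_(i <- increasing_tuples d N) F i.
Proof.
rewrite [RHS]fsbig_seq ?uniq_increasing_tuples//.
suff -> : multi_index (Some N) = [set` increasing_tuples d N] by [].
by apply/seteqP; split => i /=; rewrite mem_increasing_tuples.
Qed.

(** Multi-indices are sorted by their last, largest entry. *)
Lemma fsum_multi_index_recr (V : nmodType) d N (F : d.+1.-tuple nat -> V) :
  \sum_(i \in multi_index (Some N)) F i =
  \sum_(k < N) \sum_(j \in multi_index (Some (k : nat))) F (rcons_tuple j k).
Proof.
rewrite fsum_multi_index /= big_allpairs_dep -{1}[N]subn0 -/(index_iota 0 N).
by rewrite big_mkord; apply: eq_bigr => k _; rewrite fsum_multi_index.
Qed.

Definition sumsq (R : realType) d N (b : d.-tuple nat -> R) : R :=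
  \sum_(i \in multi_index (Some N)) b i ^+ 2.

Lemma sumsq_ge0 (R : realType) d N (b : d.-tuple nat -> R) : 0 <= sumsq N b.
Proof.
by rewrite /sumsq fsum_multi_index; apply: sumr_ge0 => i _; exact: sqr_ge0.
Qed.

Section chaos_recursion.
Context {disp : measure_display} {T : measurableType disp} {R : realType}
  {P : probability T R}.

Lemma Qfin0 (xi : nat -> 'I_0 -> {RV P >-> R}) N (b : 0.-tuple nat -> R) w :
  Qfin xi N b w = b [tuple].
Proof. by rewrite /Qfin fsum_multi_index big_seq1 /xi_prod big_ord0 mulr1. Qed.

Lemma Qfin_recr d (xi : nat -> 'I_d.+1 -> {RV P >-> R}) N
    (b : d.+1.-tuple nat -> R) w :
  Qfin xi N b w = \sum_(k < N)
    Qfin (fun i s => xi i (widen_ord (leqnSn d) s)) k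
         (fun j => b (rcons_tuple j k)) w * xi k ord_max w.
Proof.
rewrite /Qfin fsum_multi_index_recr; apply: eq_bigr => k _.
rewrite !fsum_multi_index mulr_suml; apply: eq_bigr => j _.
rewrite /xi_prod big_ord_recr /= mulrA; congr (_ * _ * _).
  apply: eq_bigr => s _; congr (xi _ _ w).
  by rewrite !(tnth_nth 0%N) /= nth_rcons size_tuple ltn_ord.
by congr (xi _ _ w); rewrite (tnth_nth 0%N) /= nth_rcons size_tuple ltnn eqxx.
Qed.

Lemma measurable_wrt_Qfin (I : choiceType) (X : I -> {RV P >-> R}) (E : set I)
    d (xi : nat -> 'I_d -> {RV P >-> R}) N (b : d.-tuple nat -> R) :
  (forall i s, (i < N)%N -> measurable_wrt X E (xi i s)) ->
  measurable_wrt X E (Qfin xi N b).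
Proof.
elim: d N xi b => [|d IH] N xi b mxi.
  by rewrite (funext (Qfin0 xi N b)); exact: measurable_cst.
rewrite (funext (Qfin_recr xi N b)); apply: measurable_sum => k.
apply: measurable_funM; last exact: mxi.
by apply: IH => i s ik; apply: mxi; exact: ltn_trans (ltn_ord k).
Qed.

(** This serves to forget some of the variables, to index the others differently,
    and to rescale them. *)
Lemma mutually_independent_comp (I I' : choiceType) (X : I -> {RV P >-> R})
    (Y : I' -> {RV P >-> R}) (h : I' -> I) (g : I' -> R -> R)
    (D : set I) (D' : set I') :
  injective h -> (forall j, D' j -> D (h j)) ->
  (forall j, measurable_fun setT (g j)) ->
  (forall j w, Y j w = g j (X (h j) w)) ->
  mutually_independent D X -> mutually_independent D' Y.
Proof.
move=> hinj hD mg YE indep J A JD' mA.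
(* Intersecting over all the [j] with [h j = i] spares an inverse of [h]. *)
pose B i := \bigcap_(j in [set j | j \in J /\ h j = i]) (g j @^-1` A j).
have mB i : measurable (B i).
  apply: fin_bigcap_measurable => [|j [jJ _]].
    by apply: (sub_finite_set _ (finite_fset J)) => j [].
  by rewrite -[X in measurable X]setTI; apply: mg => //; exact: mA.
have BE j : j \in J -> X (h j) @^-1` B (h j) = Y j @^-1` A j.
  move=> jJ; apply/seteqP; split => w /=.
    by move=> /(_ j); rewrite YE; apply.
  by rewrite YE => Aj k [_ /hinj ->].
have := indep (h @` J)%fset B; rewrite big_imfset/=; last by move=> ? ? _ _ /hinj.
have -> : (\prod_(j <- J) P (X (h j) @^-1` B (h j)) =
    \prod_(j <- J) P (Y j @^-1` A j))%E.
  by apply: eq_big_seq => j jJ; rewrite BE.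
move=> <- //.
  congr (P _); apply/seteqP; split => w.
    move=> Yw _ /imfsetP[j /= jJ ->]; change ((X (h j) @^-1` B (h j)) w).
    by rewrite BE//; exact: Yw.
  move=> Xw j jJ; change ((Y j @^-1` A j) w); rewrite -BE//; apply: Xw.
  exact: in_imfset.
by move=> _ /imfsetP[j /= jJ ->]; apply/hD/JD'.
Qed.

End chaos_recursion.

(** * The bound for finite sums *)

Lemma kappa_ge0 (R : realType) d : 0 <= kappa R d.
Proof.
elim: d => [|[|d] IH]; [exact: K_R_ge0|exact: K_R_ge0|].
have K0 : 0 <= K_Os R by apply: le_trans (K_Os_ge8 R).
by rewrite [kappa R _]/= !mulr_ge0// exprn_ge0// addr_ge0.
Qed.

Section chaos_bound.
Context {disp : measure_display} {T : measurableType disp} {R : realType}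
  (P : probability T R).

Let measurable_scale (a : R) (X : {RV P >-> R}) :
  measurable_fun setT (fun w => a * X w).
Proof. exact: measurable_funM. Qed.

Definition scale_RV (a : R) (X : {RV P >-> R}) : {RV P >-> R} :=
  HB.pack (fun w => a * X w)
    (isMeasurableFun.Build _ _ _ _ _ (@measurable_scale a X)).

Lemma centered_scale (a : R) (X : {RV P >-> R}) :
  centered X -> centered (scale_RV a X).
Proof.
move=> [iX X0].
have e : EFin \o scale_RV a X = (fun w => a%:E * (EFin \o X) w)%E.
  by apply/funext => w; rewrite /= EFinM.
split; first by rewrite e; exact: integrableZl.
rewrite unlock; move: X0; rewrite unlock => X0.
under eq_integral do rewrite EFinM.
by rewrite integralZl// X0 mule0.
Qed.

Lemma pnorm_scale_le (p a m : R) (X : {RV P >-> R}) : 0 < p -> 0 <= m ->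
  (pnorm P p X <= m%:E)%E -> (pnorm P p (scale_RV a X) <= (`|a| * m)%:E)%E.
Proof.
move=> p0 m0 /pnorm_le_moment h; apply/pnorm_le_moment; rewrite ?mulr_ge0//=.
under eq_integral do rewrite normrM powRM// EFinM.
rewrite ge0_integralZl ?lee_fin ?powR_ge0//; last first.
  by apply/measurable_EFinP; exact: measurable_norm_powR.
by rewrite powRM// EFinM lee_wpmul2l ?lee_fin ?powR_ge0//; exact: h.
Qed.

(** Rosenthal's inequality for the variables [a k * X k], the normalization by
    the number of variables being cancelled on both sides. *)
Lemma rosenthal_weighted (C p M : R) (X : nat -> {RV P >-> R}) (a : nat -> R) N :
  rosenthal_inequality C -> 2 < p -> 0 <= M ->
  mutually_independent [set k | (k < N)%N] X ->
  (forall k, (k < N)%N -> centered (X k)) ->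
  (forall k, (k < N)%N -> (pnorm P p (X k) <= M%:E)%E) ->
  (pnorm P p (fun w => \sum_(k < N) a k * X k w)%R <=
   (C * (p / ln p) * (M * Num.sqrt (\sum_(k < N) a k ^+ 2)))%:E)%E.
Proof.
move=> hC p2 M0 indep X0 XM; have p0 : 0 < p by lra.
have C0 := rosenthal_ge0 hC.
have lp : 0 < p / ln p by apply: divr_gt0; [lra|apply: ln_gt0; lra].
case: N indep X0 XM => [|N] indep X0 XM.
  rewrite pnorm0//; last by move=> w; rewrite big_ord0.
  rewrite lee_fin mulr_ge0//; first by rewrite mulr_ge0// ltW.
  by rewrite mulr_ge0// sqrtr_ge0.
pose Y (k : 'I_N.+1) := scale_RV (a k) (X k).
have YaM k : (pnorm P p (Y k) <= (`|a k| * M)%:E)%E by exact/pnorm_scale_le/XM.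
have Y_indep : mutually_independent setT Y.
  apply: (@mutually_independent_comp _ _ _ _ _ _ X Y (@nat_of_ord N.+1)
     (fun k x => a k * x) _ setT _ _ _ _ indep) => //.
  - exact: ord_inj.
  - by move=> k _; exact: ltn_ord.
  - by move=> k; apply: measurable_funM.
have := hC disp T P p N.+1 Y p2 isT Y_indep
  (fun k => centered_scale _ (X0 k (ltn_ord k)))
  (fun k => le_lt_trans (YaM k) (ltry _)).
set L := pnorm P p _.
have s0 : 0 < Num.sqrt N.+1%:R :> R by rewrite sqrtr_gt0.
rewrite sqrtrM ?invr_ge0// sqrtrV// mulrCA EFinM lee_pmul2l ?lte_fin ?invr_gt0//.
move=> h; apply: le_trans h _; rewrite lee_fin ler_wpM2l//.
  by rewrite mulr_ge0// ltW.
rewrite -[M in leRHS]ger0_norm// -sqrtr_sqr -sqrtrM ?sqr_ge0//.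
rewrite ler_sqrt ?mulr_ge0 ?sqr_ge0 ?sumr_ge0//; last by move=> *; exact: sqr_ge0.
rewrite mulr_sumr; apply: ler_sum => k _.
have Yfin : pnorm P p (Y k) \is a fin_num.
  by rewrite ge0_fin_numE ?Lnorm_ge0// (le_lt_trans (YaM k)) ?ltry.
rewrite -(real_normK (num_real (a k))) -exprMn mulrC.
rewrite lerXn2r ?nnegrE ?fine_ge0 ?Lnorm_ge0 ?mulr_ge0//.
by rewrite -lee_fin fineK.
Qed.

(** Conditionally on the first [d] families of variables, the chaos of order
    [d + 1] is a sum of independent centered variables, the variables of the last
    family, weighted by chaoses of order [d]. Its norm is therefore controlled by
    the square root of the sum of the squared norms of the weights. *)
Lemma pnorm_Qfin_le d (xi : nat -> 'I_d.+1 -> {RV P >-> R}) (n : option nat)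
    (p : R) (M : 'I_d.+1 -> R) N (b : d.+1.-tuple nat -> R) :
  mutually_independent [set im : nat * 'I_d.+1 | below n im.1]
    (fun im => xi im.1 im.2) ->
  (forall i m, below n i -> centered (xi i m)) ->
  2 < p -> (forall m, 0 <= M m) ->
  (forall i m, below n i -> (pnorm P p (xi i m) <= (M m)%:E)%E) ->
  (forall k, (k < N)%N -> below n k) ->
  (pnorm P p (Qfin xi N b) <=
   (kappa R d.+1 * (p ^+ d.+1 / ln p ^+ d.+1) * (\prod_(m < d.+1) M m) *
    Num.sqrt (sumsq N b))%:E)%E.
Proof.
move=> indep xi0 p2 M0 xiM; have p0 : 0 < p by lra.
have lp : 0 < p / ln p by apply: divr_gt0; [lra|apply: ln_gt0; lra].
elim: d xi M N b indep xi0 M0 xiM => [|d IH] xi M N b indep xi0 M0 xiM Nn.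
  have -> : Qfin xi N b =
      fun w => \sum_(k < N) b (rcons_tuple [tuple] (k : nat)) * xi k ord_max w.
    by apply/funext => w; rewrite Qfin_recr; apply: eq_bigr => k _; rewrite Qfin0.
  have -> : sumsq N b = \sum_(k < N) b (rcons_tuple [tuple] (k : nat)) ^+ 2.
    rewrite /sumsq fsum_multi_index_recr; apply: eq_bigr => k _.
    by rewrite fsum_multi_index big_seq1.
  rewrite !expr1 big_ord1 -mulrA.
  apply: (@rosenthal_weighted _ _ _ (fun k => xi k ord_max)
    (fun k => b (rcons_tuple [tuple] k))) => //.
  - exact: rosenthal_K_R.
  - apply: (@mutually_independent_comp _ _ _ _ _ _ _ _
      (fun k : nat => (k, ord_max : 'I_1)) (fun=> id) _ _ _ _ _ _ indep) => //.
    by move=> ? ? [].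
  - by move=> k kN; apply: xi0; exact: Nn.
  - by move=> k kN; rewrite (_ : ord0 = ord_max) ?ord1//; apply: xiM; exact: Nn.
pose w1 : 'I_d.+1 -> 'I_d.+2 := widen_ord (leqnSn d.+1).
pose xi' i s := xi i (w1 s).
pose Kd := kappa R d.+1 * (p ^+ d.+1 / ln p ^+ d.+1) * \prod_(m < d.+1) M (w1 m).
pose bk k j := b (rcons_tuple j k).
have Kd0 : 0 <= Kd.
  have pl0 : 0 <= p ^+ d.+1 / ln p ^+ d.+1.
    by rewrite -expr_div_n exprn_ge0// ltW.
  by rewrite mulr_ge0 ?prodr_ge0// mulr_ge0 ?kappa_ge0.
have Z_le k : (k < N)%N -> (pnorm P p (Qfin xi' k (bk k)) <=
    (Kd * Num.sqrt (sumsq k (bk k)))%:E)%E.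
  move=> kN; apply: IH => //.
  - apply: (@mutually_independent_comp _ _ _ _ _ _ _ _
      (fun im : nat * 'I_d.+1 => (im.1, w1 im.2)) (fun=> id) _ _ _ _ _ _ indep) => //.
    by move=> [i s] [j t] [-> st]; congr (_, _); exact: val_inj.
  - by move=> i m ni; exact: xi0.
  - by move=> i m ni; exact: xiM.
  - by move=> j jk; apply: Nn; exact: ltn_trans kN.
pose D := [set im : nat * 'I_d.+2 | below n im.1].
pose E := [set im : nat * 'I_d.+2 | below n im.1 /\ im.2 != ord_max].
have wE i (s : 'I_d.+1) : below n i -> E (i, w1 s).
  by move=> ni; split=> //=; rewrite -val_eqE /= ltn_eqF.
have := @pnorm_sum_orthogonal _ _ _ P _ (fun im => xi im.1 im.2) D E
  (fun k => (k, ord_max)) (fun k => Qfin xi' k (bk k))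
  (fun k => Kd * Num.sqrt (sumsq k (bk k))) (fun=> M ord_max) p N indep
  (fun im => @proj1 _ _) p2.
have hDE k : (k < N)%N -> D (k, ord_max) /\ ~ E (k, ord_max).
  by move=> kN; split; [exact: Nn|move=> [_ /=]; rewrite eqxx].
have hinj (j k : nat) : (j < k < N)%N -> (j, @ord_max d.+1) <> (k, ord_max).
  by move=> /andP[jk _] [e]; rewrite e ltnn in jk.
have mZ k : (k < N)%N -> measurable_wrt (fun im => xi im.1 im.2) E (Qfin xi' k (bk k)).
  move=> kN; apply: measurable_wrt_Qfin => i s ik.
  apply: (@measurable_wrt_var _ _ _ _ _ (fun im => xi im.1 im.2) E (i, w1 s)).
  by apply/wE/Nn; exact: ltn_trans kN.
move=> /(_ hDE hinj (fun k kN => xi0 k ord_max (Nn k kN)) mZ).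
move=> /(_ (fun k => mulr_ge0 Kd0 (sqrtr_ge0 _)) (fun=> M0 _) Z_le).
move=> /(_ (fun k kN => xiM k ord_max (Nn k kN))).
rewrite (funext (Qfin_recr xi N b)) => /le_trans; apply; rewrite lee_fin.
have -> : \sum_(k < N) (Kd * Num.sqrt (sumsq k (bk k)) * M ord_max) ^+ 2 =
    (Kd * M ord_max) ^+ 2 * sumsq N b.
  rewrite {2}/sumsq fsum_multi_index_recr mulr_sumr; apply: eq_bigr => k _.
  by rewrite mulrAC exprMn sqr_sqrtr ?sumsq_ge0.
have KM0 : 0 <= Kd * M ord_max by rewrite mulr_ge0.
rewrite sqrtrM; last by rewrite mulr_ge0// ltW.
rewrite (sqrtrM _ (sqr_ge0 _)) sqrtr_sqr ger0_norm// mulrA ler_wpM2r ?sqrtr_ge0//.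
have -> : kappa R d.+2 * (p ^+ d.+2 / ln p ^+ d.+2) * \prod_(m < d.+2) M m =
    K_Os R * (1 + d.+1%:R^-1) ^+ d.+1 * (p / ln p) * (Kd * M ord_max).
  rewrite big_ord_recr /= /Kd -!expr_div_n [(p / ln p) ^+ d.+2]exprSr.
  by rewrite -/(kappa R d.+1); ring.
rewrite ler_wpM2r//; apply: le_trans (ln_sqrt_bound p2) _.
rewrite ler_wpM2r ?(ltW lp)//.
have := K_Os_ge8 R; have : 1 <= (1 + d.+1%:R^-1 : R) ^+ d.+1.
  by rewrite exprn_ege1// lerDl invr_ge0.
by nra.
Qed.

End chaos_bound.

(** * Almost sure limits and the theorem *)

Lemma sqnorm_ge_sumsq (R : realType) d (n : option nat) N (b : d.-tuple nat -> R) :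
  (forall k, (k < N)%N -> below n k) -> ((sumsq N b)%:E <= sqnorm n b)%E.
Proof.
move=> Nn; apply: esum_ge; exists [set` increasing_tuples d N].
  split; first exact: finite_seq.
  move=> i /=; rewrite mem_increasing_tuples => /andP[si /allP iN].
  by rewrite /multi_index/= si; apply/allP => k /iN /Nn.
rewrite -fsbig_seq ?uniq_increasing_tuples//= sumEFin.
by rewrite /sumsq fsum_multi_index.
Qed.

Section limit.
Context {disp : measure_display} {T : measurableType disp} {R : realType}
  (P : probability T R).

Lemma measurable_fun_limn_einf (f : (T -> \bar R)^nat) :
  (forall k, measurable_fun setT (f k)) ->
  measurable_fun setT (fun w => limn_einf (f ^~ w)).
Proof.
move=> mf.
have -> : (fun w => limn_einf (f ^~ w)) =
    (fun w => - limn_esup ((fun k => \- f k)%E ^~ w))%E.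
  by apply/funext.
apply: measurableT_comp => //; apply: measurable_fun_limn_esup => k.
exact: measurableT_comp.
Qed.

(** Fatou's lemma, applied to the positive parts [h] of the tangent lines of the
    power function at [q w]: they are dominated by [`|Q k w| `^ p] and, being
    piecewise linear in [`|Q k w|], obviously converge to [`|q w| `^ p]. *)
Lemma pnorm_le_cvg (p c : R) (Q : nat -> T -> R) (q : T -> R) : 1 < p -> 0 <= c ->
  (forall k, measurable_fun setT (Q k)) -> measurable_fun setT q ->
  {ae P, forall w, Q k w @[k --> \oo] --> q w} ->
  (forall k, (pnorm P p (Q k) <= c%:E)%E) -> (pnorm P p q <= c%:E)%E.
Proof.
move=> p1 c0 mQ mq Qq Qc; have p0 : 0 < p by lra.
apply/pnorm_le_moment => //.
pose G k w := `|q w| `^ p + p * `|q w| `^ (p - 1) * (`|Q k w| - `|q w|).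
pose h k w := (2^-1 * (G k w + `|G k w|))%:E.
have GQ k w : G k w <= `|Q k w| `^ p by exact: powR_tangent.
have h0 k w : (0 <= h k w)%E.
  by rewrite lee_fin; have := ler_norm (- G k w); rewrite normrN; lra.
have hQ k w : (h k w <= (`|Q k w| `^ p)%:E)%E.
  rewrite lee_fin; have := GQ k w; have := powR_ge0 `|Q k w| p.
  by case: (ger0P (G k w)) => *; lra.
have mG k : measurable_fun setT (G k).
  apply: measurable_funD; first exact: measurable_norm_powR.
  apply: measurable_funM.
    by apply: measurable_funM => //; exact: measurable_norm_powR.
  by apply: measurable_funB; exact: measurableT_comp.
have mh k : measurable_fun setT (h k).
  apply/measurable_EFinP/measurable_funM => //.
  by apply: measurable_funD => //; exact: measurableT_comp.
have hq : {ae P, forall w, (`|q w| `^ p)%:E = limn_einf (h ^~ w)}.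
  apply: filterS Qq => w Qqw.
  have Gq : G k w @[k --> \oo] --> `|q w| `^ p.
    rewrite -[X in _ --> X]addr0 -(mulr0 (p * `|q w| `^ (p - 1))).
    apply: cvgD; first exact: cvg_cst.
    apply: cvgM; first exact: cvg_cst.
    rewrite -(subrr `|q w|); apply: cvgB; last exact: cvg_cst.
    exact: cvg_norm.
  have : h k w @[k --> \oo] --> (`|q w| `^ p)%:E.
    have -> : `|q w| `^ p = 2^-1 * (`|q w| `^ p + `| `|q w| `^ p |).
      by rewrite (ger0_norm (powR_ge0 _ _)); lra.
    apply: cvg_EFin; first exact: nearW.
    apply: cvgM; first exact: cvg_cst.
    by apply: cvgD => //; exact: cvg_norm.
  by move=> /cvg_limn_einf_sup[].
have -> : (\int[P]_w (`|q w| `^ p)%:E = \int[P]_w limn_einf (h ^~ w))%E.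
  apply: ae_eq_integral => //.
  - by apply/measurable_EFinP; exact: measurable_norm_powR.
  - exact: measurable_fun_limn_einf.
  - by apply: filterS hq.
apply: le_trans (fatou P measurableT mh (fun k w _ => h0 k w)) _.
rewrite limn_einf_lim; apply: lime_le; first exact: is_cvg_einfs.
apply: nearW => k; apply: (@le_trans _ _ (\int[P]_w h k w)%E).
  by apply: ereal_inf_lbound; exists k => /=.
apply: (@le_trans _ _ (\int[P]_w (`|Q k w| `^ p)%:E)%E); last first.
  exact/pnorm_le_moment.
apply: ge0_le_integral => //.
by apply/measurable_EFinP; exact: measurable_norm_powR.
Qed.

Lemma pnorm_ae0 (p : R) (q : T -> R) : 0 < p -> measurable_fun setT q ->
  {ae P, forall w, q w = 0} -> pnorm P p q = 0%E.
Proof.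
move=> p0 mq q0; apply/eqP; rewrite eq_le Lnorm_ge0 andbT.
apply/(pnorm_le_moment _ _ p0 (lexx 0)).
rewrite (ae_eq_integral (cst 0%E))//.
- by rewrite integral0 lee_fin powR_ge0.
- by apply/measurable_EFinP; exact: measurable_norm_powR.
- by apply: filterS q0 => w q0w _; rewrite q0w normr0 powR0// gt_eqF.
Qed.

End limit.

Theorem theorem3p1 (disp : measure_display) (T : measurableType disp)
    (R : realType) (P : probability T R) (d : nat) (n : option nat)
    (xi : nat -> 'I_d -> {RV P >-> R}) (p : R)
    (d_ge1 : (1 <= d)%N)
    (xi_indep : mutually_independent
       [set im : nat * 'I_d | below n im.1] (fun im => xi im.1 im.2))
    (xi_centered : forall i m, below n i -> centered (xi i m))
    (p_gt2 : 2 < p)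
    (W_fin : (W p n xi < +oo)%E) :
  (U p n xi <= (kappa R d * (p ^+ d / ln p ^+ d))%:E * W p n xi)%E.
Proof.
case: d xi d_ge1 xi_indep xi_centered W_fin => // d xi _ indep xi0 W_fin.
have p0 : 0 < p by lra.
apply: ge_ereal_sup => _ [b [q [[_ b1] Qq ->]]].
(* The empty array has norm 0, so that there is at least one index; the suprema
   [mu] are then nonnegative. *)
have [i0 ni0] : exists i0, below n i0.
  apply/not_existsP => nn.
  have : sqnorm n b = 0%E.
    apply: esum1 => i /= /andP[_ /allP ni].
    by exfalso; apply: (nn (thead i)); apply: ni; exact: mem_tnth.
  by rewrite b1 => /eqP; rewrite onee_eq0.
have mu_ge i m : below n i -> (pnorm P p (xi i m) <= mu p n xi m)%E.
  by move=> ni; apply: ereal_sup_ubound; exists i.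
have mu0 m : (0 <= mu p n xi m)%E.
  by apply: le_trans (mu_ge i0 m ni0); exact: Lnorm_ge0.
(* If some [mu] vanishes, [W] vanishes even if another [mu] is infinite. *)
have [[m m0]|mu_neq0] := pselect (exists m, mu p n xi m = 0%E).
  suff -> : pnorm P p q = 0%E by rewrite /W (bigD1 m)//= m0 mul0e mule0.
  apply: pnorm_ae0 => //.
  have xiae : {ae P, forall w, forall i, below n i -> xi i m w = 0}.
    apply: ae_foralln => i.
    have [ni|_] := boolP (below n i); last exact: aeW.
    have Xi0 : pnorm P p (xi i m) = 0%E.
      by apply/eqP; rewrite eq_le Lnorm_ge0 -m0 mu_ge.
    have mX : measurable_fun setT (EFin \o xi i m) by exact/measurable_EFinP.
    apply: filterS (Lnorm_eq0_eq0 mX _ Xi0); last by rewrite lte_fin.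
    by move=> w /(_ I) [].
  have Q0 w N : (forall k, (k < N)%N -> below n k) ->
      (forall i, below n i -> xi i m w = 0) -> Qfin xi N b w = 0.
    move=> Nn X0; rewrite /Qfin fsum_multi_index big_seq big1// => i.
    rewrite mem_increasing_tuples => /andP[_ /allP iN].
    by rewrite /xi_prod (bigD1 m)//= X0 ?mul0r ?mulr0//; apply/Nn/iN/mem_tnth.
  case: n Qq Q0 xiae {indep xi0 W_fin b1 i0 ni0 mu_ge mu0 m0} => [N|] /= Qq Q0 xiae.
    by apply: filterS xiae => w X0; rewrite Qq; exact: Q0.
  apply: filterS2 xiae Qq => w X0 Qqw.
  have : (fun N => Qfin xi N b w) = cst 0 by apply/funext => N; exact: Q0.
  by move=> e; move: Qqw; rewrite e => /(cvg_lim (@Rhausdorff _)) <-; rewrite lim_cst.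
have mu_gt0 m : (0 < mu p n xi m)%E.
  by rewrite lt_def mu0 andbT; apply/eqP => m0; apply: mu_neq0; exists m.
have mu_fin m : mu p n xi m \is a fin_num.
  rewrite ge0_fin_numE// ltey; apply/eqP => my.
  move: W_fin; rewrite /W (bigD1 m)//= my gt0_mulye ?ltxx//.
  by apply: (big_ind (fun x => 0 < x)%E) => // x y x0 y0; exact: mule_gt0.
pose M m := fine (mu p n xi m).
have M0 m : 0 <= M m by exact: fine_ge0.
have WE : W p n xi = (\prod_(m < d.+1) M m)%:E.
  rewrite /W -prodEFin; apply: eq_bigr => m _.
  by rewrite fineK.
have B0 : 0 <= kappa R d.+1 * (p ^+ d.+1 / ln p ^+ d.+1) * \prod_(m < d.+1) M m.
  rewrite mulr_ge0 ?prodr_ge0// mulr_ge0 ?kappa_ge0// -expr_div_n exprn_ge0//.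
  by rewrite divr_ge0// ?ln_ge0; lra.
have Q_le N : (forall k, (k < N)%N -> below n k) -> (pnorm P p (Qfin xi N b) <=
    (kappa R d.+1 * (p ^+ d.+1 / ln p ^+ d.+1) * \prod_(m < d.+1) M m)%:E)%E.
  move=> Nn; apply: (@le_trans _ _ _ _ _ (pnorm_Qfin_le b indep xi0 p_gt2 M0 _ Nn)).
    by move=> i m ni; rewrite fineK//; exact: mu_ge.
  rewrite lee_fin ler_piMr// -sqrtr1 ler_sqrt//.
  by have := sqnorm_ge_sumsq b Nn; rewrite b1 lee_fin.
rewrite WE -EFinM; move: Qq; rewrite /is_Q; case En: n => [N|] Qq.
  have -> : (q : T -> R) = Qfin xi N b by apply/funext.
  by apply: Q_le => k kN; rewrite En.
apply: pnorm_le_cvg Qq _ => //; first by lra.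
- move=> N; apply: (@measurable_wrt_measurable _ _ _ P _
    (fun im : nat * 'I_d.+1 => xi im.1 im.2) setT).
  apply: measurable_wrt_Qfin => i s _.
  exact: (@measurable_wrt_var _ _ _ P _ (fun im => xi im.1 im.2) setT (i, s)).
- by move=> N; apply: Q_le => k _; rewrite En.
Qed.
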